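(* Let $\{\mathfrak{n}=V\oplus\mathfrak{g},B^*\}$ be the complex 2-step nilpotent Lie algebra described in the context. If $v\in V$, then $\mathrm{im}(\mathrm{ad}\,v)=\mathfrak{g}_v^{\perp}$, where $\mathrm{ad}\,v:\mathfrak{n}\to\mathfrak{g}$, $\xi\mapsto[v,\xi]$, is taken in $\mathfrak{n}$, $\mathfrak{g}_v=\{X\in\mathfrak{g}: X(v)=0\}$ and $\mathfrak{g}_v^{\perp}=\{X\in\mathfrak{g}: B^*(X,Y)=0\text{ for all }Y\in\mathfrak{g}_v\}$.
   Context: $\mathfrak{g}$ is a complex semisimple Lie algebra and $V$ is a finite dimensional complex $\mathfrak{g}$-module. $B^*$ is a nondegenerate symmetric complex bilinear form on $\mathfrak{n}=V\oplus\mathfrak{g}$ such that $V$ and $\mathfrak{g}$ are $B^*$-orthogonal, $B^*(Xv,v')+B^*(v,Xv')=0$ for $v,v'\in V$, $X\in\mathfrak{g}$, and $B^*(\mathrm{ad}X(Y),Z)+B^*(Y,\mathrm{ad}X(Z))=0$ for $X,Y,Z\in\mathfrak{g}$ (with $\mathrm{ad}$ of $\mathfrak{g}$). The bracket of $\mathfrak{n}$ is defined by: $\mathfrak{g}$ is central in $\mathfrak{n}$, $[\mathfrak{n},\mathfrak{n}]\subseteq\mathfrak{g}$, and $B^*([v,v'],Z)=B^*(Zv,v')$ for $v,v'\in V$, $Z\in\mathfrak{g}$. *)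

(* Defs.v *)
From HB Require Import structures.
From mathcomp Require Import all_boot all_order all_algebra.
From mathcomp Require Import sesquilinear complex.
From mathcomp Require Import classical_sets reals.

Set Implicit Arguments.
Unset Strict Implicit.
Unset Printing Implicit Defensive.

Import GRing.Theory.

Local Open Scope ring_scope.
Local Open Scope classical_set_scope.

Section LieAlgebra.
Context {K : fieldType} {L : vectType K}.
Variable br : {bilinear L -> L -> L}.

Record is_lie_bracket : Prop := {
  lie_alternating : forall x, br x x = 0;
  lie_jacobi : forall x y z,
    br x (br y z) + br y (br z x) + br z (br x y) = 0
}.

Definition lie_ideal (I : {vspace L}) : Prop :=
  forall x y, y \in I -> br x y \in I.

(* By bilinearity, brackets of basis vectors span [U, W]. *)
Definition bracket_vs (U W : {vspace L}) : {vspace L} :=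
  <<[seq br x y | x <- vbasis U, y <- vbasis W]>>%VS.

Fixpoint derived_series (U : {vspace L}) (k : nat) : {vspace L} :=
  if k is k'.+1
  then bracket_vs (derived_series U k') (derived_series U k')
  else U.

Definition lie_solvable (U : {vspace L}) : Prop :=
  exists k, derived_series U k = 0%VS.

(* The solvable radical vanishes. *)
Definition lie_semisimple : Prop :=
  forall I : {vspace L}, lie_ideal I -> lie_solvable I -> I = 0%VS.

End LieAlgebra.

Section TwoStep.
Context {K : fieldType} {g V : vectType K}.
Variables (brg : {bilinear g -> g -> g}) (act : {bilinear g -> V -> V}).

Definition is_lie_module : Prop :=
  forall X Y v, act (brg X Y) v = act X (act Y v) - act Y (act X v).

Local Notation n := (V * g)%type.

(* v in V and X in g are identified with (v, 0) and (0, X) in n. *)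
Definition inV (v : V) : n := (v, 0).
Definition ing (X : g) : n := (0, X).

Variable B : {symmetric n}.

Record invariant_form : Prop := {
  form_orthogonal : forall v X, B (inV v) (ing X) = 0;
  form_invariant_V : forall X v v',
    B (inV (act X v)) (inV v') + B (inV v) (inV (act X v')) = 0;
  form_invariant_g : forall X Y Z,
    B (ing (brg X Y)) (ing Z) + B (ing Y) (ing (brg X Z)) = 0
}.

Variable brn : {bilinear n -> n -> n}.

(* For nondegenerate B these conditions determine brn. *)
Record two_step_bracket : Prop := {
  g_central : forall X xi, brn (ing X) xi = 0;
  bracket_in_g : forall xi eta, exists Z, brn xi eta = ing Z;
  bracket_form : forall v v' Z,
    B (brn (inV v) (inV v')) (ing Z) = B (inV (act Z v)) (inV v')
}.

(* By bracket_in_g, the first component of the bracket is 0. *)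
Definition ad_n (v : V) (xi : n) : g := (brn (inV v) xi).2.

Definition stabilizer (v : V) : set g := [set X | act X v = 0].

Definition orth_g (S : set g) : set g :=
  [set X | forall Y, S Y -> B (ing X) (ing Y) = 0].

End TwoStep.

(* Main.v *)
Require Import Defs.
From HB Require Import structures.
From mathcomp Require Import all_boot all_order all_algebra.
From mathcomp Require Import sesquilinear complex.
From mathcomp Require Import classical_sets reals.

(** By the definition of the bracket, [B([v, v'], Y) = B(Yv, v')] for [Y] in
    [g]: up to [B], the map [v' |-> [v, v']] is the transpose of the orbit map
    [Y |-> Yv], whose kernel is the stabilizer of [v]. The proposition is the
    duality between the image of a transpose and the annihilator of a kernel.

    One inclusion is read off that identity. Conversely, if [X] is orthogonal to
    the stabilizer, then the functional [Y |-> B(X, Y)] vanishes on the kernel of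
    the orbit map, hence equals [Y |-> psi(Yv)] for a functional [psi] on [V]
    ([functional_factor]). Nondegeneracy represents [psi] as [B(v', .)]
    ([nondegenerate_represents]), with [v'] in [V] because [V] and [g] are
    orthogonal. Then [B(X, Y) = B(Yv, v') = B([v, v'], Y)] for all [Y], and
    nondegeneracy on [g] gives [X = [v, v']]. *)

Set Implicit Arguments.

Import GRing.Theory.
Local Open Scope ring_scope.
Local Open Scope classical_set_scope.

(** The pseudo-inverse [f^-1] picks a preimage of each [f u]; it differs from [u]
    by an element of the kernel of [f], which [phi] does not see. *)
Lemma functional_factor (F : fieldType) (U W : vectType F)
    (f : 'Hom(U, W)) (phi : 'Hom(U, F^o)) :
  (lker f <= lker phi)%VS -> exists psi : 'Hom(W, F^o), phi = (psi \o f)%VF.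
Proof.
move=> sfphi; exists (phi \o f^-1)%VF; apply/lfunP => u.
rewrite !comp_lfunE; apply/eqP.
rewrite -subr_eq0 -linearB -memv_ker (subvP sfphi) // memv_ker linearB /=.
by rewrite limg_lfunVK ?subrr // memv_img ?memvf.
Qed.

Lemma lie_bracketC (F : fieldType) (L : vectType F)
    (br : {bilinear L -> L -> L}) :
  is_lie_bracket br -> forall x y, br x y = - br y x.
Proof.
move=> brP x y; apply/eqP; rewrite -addr_eq0.
have := lie_alternating brP (x + y).
by rewrite linearDl !linearDr /= !(lie_alternating brP) add0r addr0 => ->.
Qed.

Section SymmetricForm.
Variables (F : fieldType) (U : vectType F) (B : {symmetric U}).

Lemma symmetric_formC x y : B x y = B y x.
Proof. by rewrite hermC expr0 mul1r. Qed.

Lemma nondegenerate_eq0 x : nondegenerate B -> (forall y, B x y = 0) -> x = 0.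
Proof.
move=> /eqP rad0 Bx0; apply/eqP; rewrite -memv0 -rad0.
by apply/mem_orthovP => y _.
Qed.

Definition form_dual (x : U) : 'Hom(U, F^o) := linfun (B x : U -> F^o).

Fact form_dual_linear : linear form_dual.
Proof.
move=> a x y; apply/lfunP => z.
by rewrite add_lfunE scale_lfunE !lfunE /= linearPl.
Qed.

HB.instance Definition _ :=
  GRing.isLinear.Build F U 'Hom(U, F^o) *:%R form_dual form_dual_linear.

(** Nondegeneracy makes the map from [U] to its dual injective, and both
    spaces have the same dimension. *)
Lemma nondegenerate_represents (phi : 'Hom(U, F^o)) :
  nondegenerate B -> exists x, forall y, B x y = phi y.
Proof.
move=> ndB; pose rho := linfun form_dual.
have ker0 : lker rho == 0%VS.
  rewrite -subv0; apply/subvP => x; rewrite memv_ker lfunE /= memv0 => /eqP x0.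
  apply/eqP/nondegenerate_eq0 => // y.
  by move/lfunP/(_ y): x0; rewrite zero_lfunE [form_dual x]/(linfun _) lfunE.
have im_full : (rho @: fullv)%VS = fullv.
  apply/eqP; rewrite eqEdim subvf limg_dim_eq ?(eqP ker0) ?capv0 //.
  by rewrite !dimvf /dim /= muln1.
have /memv_imgP[x _ ->] : phi \in (rho @: fullv)%VS by rewrite im_full memvf.
by exists x => y; rewrite lfunE /= /form_dual lfunE.
Qed.

End SymmetricForm.

Section TwoStep.
Variables (F : fieldType) (g V : vectType F).
Variables (brg : {bilinear g -> g -> g}) (act : {bilinear g -> V -> V}).
Variable B : {symmetric (V * g)%type}.
Variable brn : {bilinear (V * g)%type -> (V * g)%type -> (V * g)%type}.
Hypothesis brn_lie : is_lie_bracket brn.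
Hypothesis ndB : nondegenerate B.
Hypothesis invB : invariant_form brg act B.
Hypothesis brnP : two_step_bracket act B brn.

Fact ing_linear : linear (ing : g -> V * g).
Proof.
by move=> a X Y; rewrite /ing [RHS]surjective_pairing /= scaler0 addr0.
Qed.

HB.instance Definition _ :=
  GRing.isLinear.Build F g (V * g)%type *:%R (@ing F g V) ing_linear.

Lemma inV_ingD (x : V * g) : x = inV x.1 + ing x.2.
Proof. by rewrite [RHS]surjective_pairing /= addr0 add0r -surjective_pairing. Qed.

Lemma form_ing_eq (X Y : g) :
  (forall Z, B (ing X) (ing Z) = B (ing Y) (ing Z)) -> X = Y.
Proof.
move=> eqXY; have /eqP : ing X - ing Y = 0 :> V * g.
  apply: (@nondegenerate_eq0 _ _ B) => // y.
  rewrite (inV_ingD y) linearDr !linearBl /= eqXY subrr addr0.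
  by rewrite -!(symmetric_formC B (inV _)) !(form_orthogonal invB) subrr.
by rewrite subr_eq0 => /eqP[].
Qed.

(** The transpose identity. It extends from [v'] in [V] to all [xi] because
    [g], being central, makes the [g]-component of [xi] invisible to [v]. *)
Lemma form_ad_n v (xi : V * g) Z :
  B (ing (ad_n brn v xi)) (ing Z) = B (inV (act Z v)) (inV xi.1).
Proof.
rewrite -(bracket_form brnP).
have -> : ing (ad_n brn v xi) = brn (inV v) xi.
  by rewrite /ad_n; have [Y ->] := bracket_in_g brnP (inV v) xi.
rewrite [in LHS](inV_ingD xi) linearDr /= (lie_bracketC brn_lie _ (ing _)).
by rewrite (g_central brnP) oppr0 addr0.
Qed.

Lemma orth_stabilizer_in_range v X :
  orth_g B (stabilizer act v) X -> exists v', ad_n brn v (inV v') = X.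
Proof.
move=> orthX.
pose orbit : 'Hom(g, V) := linfun (applyr act v : g -> V).
pose BX : 'Hom(g, F^o) := linfun (B (ing X) \o ing : g -> F^o).
have orbitE Y : orbit Y = act Y v by rewrite lfunE.
have BXE Y : BX Y = B (ing X) (ing Y) by rewrite lfunE.
have /functional_factor[psi BXpsi] : (lker orbit <= lker BX)%VS.
  apply/subvP => Y; rewrite !memv_ker orbitE BXE => /eqP Yv0.
  by apply/eqP; apply: orthX.
(* The extension of [psi] by zero on [g], since the form represents
   functionals on the whole of [V * g]. *)
pose psi_n : 'Hom((V * g)%type, F^o) := linfun (psi \o fst : V * g -> F^o).
have [x Bx] := nondegenerate_represents _ psi_n ndB.
exists x.1; apply: form_ing_eq => Y; rewrite form_ad_n /=.
rewrite -BXE BXpsi comp_lfunE orbitE.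
have -> : psi (act Y v) = B x (inV (act Y v)) by rewrite Bx lfunE.
rewrite [in RHS](inV_ingD x) linearDl /= [B (ing _) _]symmetric_formC.
by rewrite (form_orthogonal invB) addr0 symmetric_formC.
Qed.

End TwoStep.

Unset Implicit Arguments.

Theorem proposition4p8 (R : realType) (g V : vectType (complex R))
    (brg : {bilinear g -> g -> g}) (act : {bilinear g -> V -> V})
    (B : {symmetric (V * g)%type})
    (brn : {bilinear (V * g)%type -> (V * g)%type -> (V * g)%type}) :
  is_lie_bracket brg -> lie_semisimple brg -> is_lie_module brg act ->
  nondegenerate B -> invariant_form brg act B ->
  is_lie_bracket brn -> two_step_bracket act B brn ->
  forall v : V, range (ad_n brn v) = orth_g B (stabilizer act v).
Proof.
move=> _ _ _ ndB invB brn_lie brnP v; apply/seteqP; split=> [_ [xi _ <-] Y Yv0|X].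
  by rewrite (form_ad_n brn_lie brnP) Yv0 [inV 0]/(0 : V * g) linear0l.
move=> /(orth_stabilizer_in_range brn_lie ndB invB brnP)[v' <-].
by exists (inV v').
Qed.
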